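(* Let $D$ be a distortion function and let $Q$ be the probability measure on $\mathcal{B}((0,1))$ corresponding to $D$. The domain $\mathcal{L}_Q$ of the quantile risk measure $\varrho_Q$ satisfies $$\mathcal{L}_Q = \Bigl\{ X\in\mathcal{L}^0 \Bigm| \int_{\mathbb{R}} x^+\,dQ^{D\circ F_X}(x) < \infty \Bigr\} = \Bigl\{ X\in\mathcal{L}^0 \Bigm| \int_{(0,\infty)} \bigl(1-(D\circ F_X)(x)\bigr)\,d\lambda(x) < \infty \Bigr\},$$ and for every $X\in\mathcal{L}_Q$ the identities $$\varrho_Q[X] = \int_{\mathbb{R}} x\,dQ^{D\circ F_X}(x) = \int_{(0,\infty)} \bigl(1-(D\circ F_X)(x)\bigr)\,d\lambda(x) - \int_{(-\infty,0)} (D\circ F_X)(x)\,d\lambda(x)$$ hold (as values in $[-\infty,\infty)$).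
   Context: ''Increasing'' and ''positive'' are meant in the weak sense. $(\Omega,\mathcal{F},P)$ is a fixed probability space and $\mathcal{L}^0$ is the set of all real random variables on it. $\lambda$ denotes Lebesgue measure on $\mathcal{B}(\mathbb{R})$ or its restriction to $\mathcal{B}((0,1))$. For $X\in\mathcal{L}^0$, $F_X(x):=P[\{X\le x\}]$ is its distribution function and $F_X^\leftarrow:(0,1)\to\mathbb{R}$, $F_X^\leftarrow(u):=\inf\{x\in\mathbb{R}\mid F_X(x)\ge u\}$, is its (lower) quantile function. A distortion function is an increasing, right-continuous function $D:[0,1]\to[0,1]$ with $D(0)=0$ and $\sup_{u\in(0,1)}D(u)=1$ (hence $D(1)=1$). The probability measure $Q$ on $\mathcal{B}((0,1))$ corresponding to $D$ is the unique one with $Q[(0,u]]=D(u)$ for all $u\in(0,1)$. For a distribution function $G$ on $\mathbb{R}$, $Q^G$ is the probability measure on $\mathcal{B}(\mathbb{R})$ with $Q^G[(x,y]]=G(y)-G(x)$ for all $x\le y$; the function $D\circ F_X$ is a distribution function on $\mathbb{R}$. $\mathcal{L}_Q:=\{X\in\mathcal{L}^0\mid\int_{(0,1)}(F_X^\leftarrow(u))^+\,dQ(u)<\infty\}$, and the quantile risk measure $\varrho_Q:\mathcal{L}_Q\to[-\infty,\infty)$ is $\varrho_Q[X]:=\int_{(0,1)}F_X^\leftarrow(u)\,dQ(u)$. *)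

(* Defs.v *)
From HB Require Import structures.
From mathcomp Require Import all_boot all_order all_algebra.
From mathcomp Require Import all_classical all_reals all_analysis.
Set Implicit Arguments.
Unset Strict Implicit.
Unset Printing Implicit Defensive.
Import Order.TTheory GRing.Theory Num.Theory.
Import numFieldNormedType.Exports.
Local Open Scope classical_set_scope.
Local Open Scope ring_scope.

(* A function [0, 1] -> [0, 1] is encoded as a total function R -> R of which
   only the values on [0, 1] are constrained.  Right-continuity is required on
   [0, 1[, being vacuous at the right endpoint of the domain. *)
Record distortion (R : realType) := Distortion {
  distortion_fun :> R -> R ;
  distortion_itv : forall u, u \in `[0, 1] -> distortion_fun u \in `[0, 1] ;
  distortion_nd : {in `[0, 1] &, {homo distortion_fun : u v / u <= v}} ;
  distortion_rc : forall u, u \in `[0, 1[ ->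
    distortion_fun x @[x --> u^'+] --> distortion_fun u ;
  distortion0 : distortion_fun 0 = 0 ;
  distortion_sup : sup [set distortion_fun u | u in `]0, 1[%classic] = 1 }.
Arguments distortion_itv {R} _ [u].
Arguments distortion_rc {R} _ [u].
Arguments distortion0 {R} _.
Arguments distortion_sup {R} _.

(* A probability measure on B((0,1)) is encoded as a Borel probability measure
   on R concentrated on ]0, 1[; integrals against it are taken over ]0, 1[. *)
Definition corresponds (R : realType) (D : distortion R)
    (Q : probability (measurableTypeR R) R) : Prop :=
  Q `]0, 1[%classic = 1%E /\ forall u, u \in `]0, 1[ -> Q `]0, u]%classic = (D u)%:E.

Section distribution_function.
Context d (T : measurableType d) (R : realType) (P : probability T R).
Implicit Type X : {RV P >-> R}.

(* The library's cdf takes its values in \bar R. *)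
Definition df X (x : R) : R := fine (cdf X x).

(* The infimum is used only for u in ]0, 1[, where the set is nonempty and
   bounded from below; outside that range the value is irrelevant. *)
Definition quantile X (u : R) : R := inf [set x | u <= df X x].

Lemma df_itv X x : df X x \in `[0, 1].
Proof.
rewrite in_itv/= /df fine_ge0 ?cdf_ge0//=.
by rewrite -lee_fin fineK ?fin_num_measure// cdf_le1.
Qed.

Lemma df_nd X : {homo df X : x y / x <= y}.
Proof.
by move=> x y xy; rewrite fine_le ?fin_num_measure// cdf_nondecreasing.
Qed.

Lemma df_rc X : right_continuous (df X).
Proof.
move=> a; apply: fine_cvg.
by rewrite fineK ?fin_num_measure//; exact: cdf_right_continuous.
Qed.

Lemma df_cvgNy X : df X @ -oo --> (0 : R).
Proof. exact/fine_cvg/cvg_cdfNy0. Qed.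

Lemma df_cvgy X : df X @ +oo --> (1 : R).
Proof. exact/fine_cvg/cvg_cdfy1. Qed.

End distribution_function.

Section distorted_distribution_function.
Context d (T : measurableType d) (R : realType) (P : probability T R).
Variables (D : distortion R) (X : {RV P >-> R}).

Lemma distortion1 : D 1 = 1.
Proof.
have u01 (u : R) : u \in `]0, 1[ -> u \in `[0, 1].
  by rewrite !in_itv/= => /andP[/ltW -> /ltW ->].
have I1 : (1 : R) \in `[0, 1] by rewrite in_itv/= ler01 lexx.
apply/eqP; rewrite eq_le; apply/andP; split.
  by have := distortion_itv D I1; rewrite in_itv/= => /andP[].
rewrite -{1}(distortion_sup D); apply: ge_sup.
  exists (D (2^-1)), 2^-1 => //=.
  by rewrite in_itv/= invr_gt0 ltr0n invf_lt1// ltr1n.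
move=> _ [u /= u01' <-]; apply: distortion_nd => //; first exact: u01.
by move: u01'; rewrite in_itv/= => /andP[_ /ltW].
Qed.

Let near_right_of (c e : R) : c \in `[0, 1[ -> 0 < e ->
  exists2 r : R, 0 < r & forall y, y \in `[0, 1] -> c <= y -> y < c + r ->
    `|D c - D y| < e.
Proof.
move=> c01 e0; have /cvgrPdist_lt/(_ _ e0) := distortion_rc D c01.
case=> r /= r0 H; exists r => // y _; rewrite le_eqVlt => /predU1P[<- _|cy yr].
  by rewrite subrr normr0.
by apply: H => //=; rewrite distrC gtr0_norm ?subr_gt0// ltrBlDl.
Qed.

Let D_df_nd : nondecreasing (D \o df X).
Proof. by move=> x y xy; apply: distortion_nd; rewrite ?df_itv ?df_nd. Qed.

Let D_df_rc : right_continuous (D \o df X).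
Proof.
move=> a /=; apply/cvgrPdist_lt => e e0.
have : df X a <= 1 by have := df_itv X a; rewrite in_itv => /andP[].
rewrite le_eqVlt => /predU1P[a1|a1].
  near=> y; rewrite /= (_ : df X y = df X a) ?subrr ?normr0//.
  apply/eqP; rewrite eq_le; apply/andP; split.
    by rewrite a1; have := df_itv X y; rewrite in_itv => /andP[].
  by apply: df_nd; near: y; exact: nbhs_right_ge.
have a01 : df X a \in `[0, 1[.
  by have := df_itv X a; rewrite !in_itv/= a1 => /andP[->].
have [r r0 H] := near_right_of a01 e0.
have /cvgrPdist_lt/(_ _ r0) K := @df_rc _ _ _ _ X a.
near=> y; apply: H; first exact: df_itv.
  by apply: df_nd; near: y; exact: nbhs_right_ge.
rewrite -ltrBlDl; apply: le_lt_trans (ler_norm _) _.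
by rewrite distrC; near: y; exact: K.
Unshelve. all: by end_near. Qed.

Let D_df_cvgNy : (D \o df X) @ -oo --> (0 : R).
Proof.
apply/cvgrPdist_lt => e e0.
have z01 : (0 : R) \in `[0, 1[ by rewrite in_itv/= lexx ltr01.
have [r r0 H] := near_right_of z01 e0.
have /cvgrPdist_lt/(_ _ r0) K := @df_cvgNy _ _ _ _ X.
near=> y; rewrite -{1}(distortion0 D) /=; apply: H; first exact: df_itv.
  by have := df_itv X y; rewrite in_itv => /andP[].
rewrite add0r; apply: le_lt_trans (ler_norm _) _.
by rewrite -[X in `|X|]subr0 distrC; near: y; exact: K.
Unshelve. all: by end_near. Qed.

Let D_df_cvgy : (D \o df X) @ +oo --> (1 : R).
Proof.
apply/cvgrPdist_lt => e e0.
have [|u] := @sup_adherent _ [set D u | u in `]0, 1[%classic] e e0.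
  split; first by exists (D (2^-1)), 2^-1 => //=;
    rewrite in_itv/= invr_gt0 ltr0n invf_lt1// ltr1n.
  exists 1 => _ [u /= + <-]; rewrite in_itv/= => /andP[u0 u1].
  have := @distortion_itv _ D u; rewrite !in_itv/= (ltW u0) (ltW u1).
  by move=> /(_ isT)/andP[].
move=> [v /= v01 <-]; rewrite distortion_sup => Dv.
have := v01; rewrite in_itv/= => /andP[v0 v1].
have v1' : 0 < 1 - v by rewrite subr_gt0.
have /cvgrPdist_lt/(_ _ v1') K := @df_cvgy _ _ _ _ X.
near=> y.
have vy : v <= df X y.
  have : `|1 - df X y| < 1 - v by near: y; exact: K.
  by move=> /(le_lt_trans (ler_norm _)); rewrite ltrD2l ltrN2 => /ltW.
have Dvy : D v <= D (df X y).
  by apply: distortion_nd => //; rewrite ?df_itv// in_itv/= !ltW.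
rewrite ger0_norm ?subr_ge0 /=.
  by rewrite ltrBlDr -ltrBlDl; apply: lt_le_trans Dvy.
by have := distortion_itv D (df_itv X y); rewrite in_itv/= => /andP[].
Unshelve. all: by end_near. Qed.

HB.instance Definition _ :=
  isCumulative.Build R _ R (D \o df X) D_df_nd D_df_rc.

HB.instance Definition _ :=
  isCumulativeBounded.Build R 0 1 (D \o df X) D_df_cvgNy D_df_cvgy.

End distorted_distribution_function.

(* Q^G for a distribution function G; it is a probability measure by the
   library's instance on lebesgue_stieltjes_measure. *)
Definition Qdf (R : realType) (G : cumulativeBounded (0 : R) (1 : R)) :
  probability (measurableTypeR R) R := lebesgue_stieltjes_measure G.

Lemma QdfE (R : realType) (G : cumulativeBounded (0 : R) (1 : R)) (x y : R) :
  x <= y -> Qdf G `]x, y]%classic = (G y - G x)%:E.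
Proof.
move=> xy; rewrite /Qdf /= /lebesgue_stieltjes_measure /measure_extension.
by rewrite measurable_mu_extE/= ?wlength_itv_bnd//; exact: is_ocitv.
Qed.

Section quantile_risk_measure.
Context d (T : measurableType d) (R : realType) (P : probability T R).
Variable Q : probability (measurableTypeR R) R.

Definition LQ : set {RV P >-> R} :=
  [set X | \int[Q]_(u in `]0%R, 1%R[) (Num.max (quantile X u) 0)%:E < +oo]%E.

(* Meaningful for X in LQ, where the positive part has a finite integral. *)
Definition rho (X : {RV P >-> R}) : \bar R :=
  (\int[Q]_(u in `]0%R, 1%R[) (quantile X u)%:E)%E.

End quantile_risk_measure.
Arguments LQ {d T R} P Q.

(* Main.v *)
(* The quantile function satisfies the Galois relation
   [F_X^<-(u) <= x <-> u <= F_X(x)] on ]0, 1[, so that its distribution function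
   under Q is D o F_X; hence the image of Q under it is Q^(D o F_X).  The
   integrals over R follow by a change of variables, and those against Lebesgue
   measure by the tail formula applied separately to the positive and negative
   parts, which also covers the case where the negative part is not integrable. *)
Require Import Defs.
From HB Require Import structures.
From mathcomp Require Import all_boot all_order all_algebra.
From mathcomp Require Import all_classical all_reals all_analysis.
From mathcomp Require Import measurable_realfun.
Import Order.TTheory GRing.Theory Num.Theory.
Import numFieldNormedType.Exports.
Local Open Scope classical_set_scope.
Local Open Scope ereal_scope.

(** Both integrals are differences of the integrals of the positive and negative parts, and the
    nonnegative change of variables applies to each; infinite values are thus covered. *)
Lemma integral_distributionT {d d' : measure_display} {T : measurableType d}
    {T' : measurableType d'} {R : realType} {P : probability T R}
    (Y : {RV P >-> T'}) (f : T' -> \bar R) : measurable_fun [set: T'] f ->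
  \int[distribution P Y]_x f x = \int[P]_t f (Y t).
Proof.
move=> mf; rewrite integralE [RHS]integralE.
rewrite ge0_integral_distribution//; last exact: measurable_funepos.
rewrite ge0_integral_distribution//; last exact: measurable_funeneg.
by congr (_ - _); apply: eq_integral => t _; rewrite /= ?funeposE ?funenegE.
Qed.

Section tail_formulas.
Context {d : measure_display} {T : measurableType d} {R : realType}.
Context {P : probability T R}.
Variable Y : {RV P >-> R}.

Lemma integral_max0_ccdf : \int[P]_t (Num.max (Y t) 0%R)%:E =
  \int[lebesgue_measure]_(r in `]0%R, +oo[) ccdf Y r.
Proof.
have := @ge0_expectation_ccdf _ _ _ P Y^\+%R (@funrpos_ge0 _ _ Y).
rewrite expectation_def => ->.
rewrite -integral_itv_obnd_cbnd; last first.
  by apply: measurable_funTS; exact: ccdf_measurable.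
apply: eq_integral => r; rewrite inE/= in_itv/= andbT => r0.
congr (P _); apply/seteqP; split => t /=; rewrite !in_itv/= !andbT lt_max.
  by rewrite (ltNge r 0%R) ltW// orbF.
by move=> ->.
Qed.

(** The tail formula for nonpositive variables is applied to [- Y^\-], the minimum of [Y] and 0,
    whose cdf agrees with that of [Y] at every r < 0, though not in general at 0. *)
Lemma integral_maxN0_cdf : \int[P]_t (Num.max (- Y t) 0%R)%:E =
  \int[lebesgue_measure]_(r in `]-oo, 0%R[) cdf Y r.
Proof.
have NYle0 t : ((- Y^\-) t <= 0)%R by rewrite oppr_le0 funrneg_ge0.
have := @le0_expectation_cdf _ _ _ P (- Y^\-)%R NYle0.
rewrite expectation_def.
have -> : \int[P]_t ((- Y^\-)%R t)%:E = - \int[P]_t (Num.max (- Y t) 0%R)%:E.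
  by rewrite -integral_ge0N// => t _; rewrite lee_fin le_max lexx orbT.
move=> /(congr1 oppe); rewrite !oppeK => ->.
apply: eq_integral => r; rewrite inE/= in_itv/= => r0.
congr (P _); apply/seteqP; split => t /=; rewrite !in_itv/= lerNl le_max lerN2.
  by rewrite oppr_le0 (leNgt 0%R) r0 orbF.
by move=> ->.
Qed.

Lemma integral_ccdf_cdf : \int[P]_t (Y t)%:E =
  \int[lebesgue_measure]_(r in `]0%R, +oo[) ccdf Y r -
  \int[lebesgue_measure]_(r in `]-oo, 0%R[) cdf Y r.
Proof.
rewrite -integral_max0_ccdf -integral_maxN0_cdf integralE.
by congr (_ - _); apply: eq_integral => t _;
  rewrite ?funeposE ?funenegE EFin_max.
Qed.

End tail_formulas.

Section quantile.
Context {d : measure_display} {T : measurableType d} {R : realType}.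
Context {P : probability T R}.
Variable X : {RV P >-> R}.
Local Open Scope ring_scope.

Lemma has_inf_quantile (u : R) : u \in `]0, 1[ ->
  has_inf [set x | u <= df X x].
Proof.
rewrite in_itv/= => /andP[u0 u1]; split.
- have /cvgr_ge/(_ _ u1)[M [_ MF]] := df_cvgy X.
  by exists (M + 1); apply: MF; rewrite ltrDl.
- have /cvgr_lt/(_ _ u0)[M [_ MF]] := df_cvgNy X.
  exists M => x /= ux; rewrite leNgt; apply/negP => /MF.
  by rewrite ltNge ux.
Qed.

(** Right-continuity makes the infimum attained: if it is at most x, then every y > x lies above
    some s with u <= F(s), so u <= F(y), and y decreases to x. *)
Lemma quantile_le (u x : R) : u \in `]0, 1[ ->
  (quantile X u <= x) = (u <= df X x).
Proof.
move=> u01; have infS := has_inf_quantile _ u01.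
apply/idP/idP => [qx|ux]; last by apply: ge_inf => //; exact: infS.2.
apply: (cvgr_to_ge (@df_rc _ _ _ _ X x)); near=> y.
have xy : x < y by near: y; exact: nbhs_right_gt.
have [s /= us sy] := inf_lt infS.1 (le_lt_trans qx xy).
by rewrite (le_trans us)// df_nd// ltW.
Unshelve. all: by end_near. Qed.

Lemma measurable_quantile : measurable_fun (`]0, 1[%classic : set R) (quantile X).
Proof.
apply: (measurability (@RGenOInfty.G R)) => [|/= _ [_] [x] -> <-].
  exact: RGenOInfty.measurableE.
rewrite (_ : _ `&` _ = `]0, 1[ `&` `]df X x, +oo[)%classic.
  exact: measurableI.
apply/seteqP; split=> u [/= u01]; rewrite !in_itv/= !andbT => h; split=> //.
  by rewrite ltNge -quantile_le// -ltNge.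
by rewrite ltNge quantile_le// -ltNge.
Qed.

(* The quantile function is only meaningful on ]0, 1[, hence the restriction
   needed to view it as a random variable on (R, Q). *)
Definition quantile01 : measurableTypeR R -> R :=
  quantile X \_ `]0, 1[%classic.

Lemma measurable_quantile01 : measurable_fun [set: measurableTypeR R] quantile01.
Proof.
apply: (measurable_restrictT (quantile X) _).1; last exact: measurable_quantile.
exact: measurable_itv.
Qed.

HB.instance Definition _ := isMeasurableFun.Build _ _ _ _ quantile01
  measurable_quantile01.

End quantile.

Section distorted_quantile.
Context {d : measure_display} {T : measurableType d} {R : realType}.
Context {P : probability T R} {Q : probability (measurableTypeR R) R}.
Variables (D : distortion R) (QD : corresponds D Q) (X : {RV P >-> R}).

Let Y : {RV Q >-> R} := quantile01 X.

(** The complement of ]0, 1[ is Q-null, so the value 0 that [quantile01] takes there does not affect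
    its law. *)
Lemma corresponds_setI (A : set (measurableTypeR R)) : measurable A ->
  Q A = Q (`]0%R, 1%R[%classic `&` A).
Proof.
move=> mA; have mI : measurable (`]0%R, 1%R[%classic : set (measurableTypeR R)).
  exact: measurable_itv.
rewrite -[in LHS](setTI A) -(setUv `]0%R, 1%R[%classic) setIUl measureU.
- rewrite [X in _ + X](_ : _ = 0) ?adde0//.
  apply: (subset_measure0 _ _ (@subIsetl _ _ _)) => //.
  + by apply: measurableI => //; exact: measurableC.
  + exact: measurableC.
  + by have := probability_setC Q mI; rewrite QD.1 subee.
- exact: measurableI.
- by apply: measurableI => //; exact: measurableC.
- by rewrite setIACA setICr set0I.
Qed.

Lemma cdf_quantile01 (r : R) : cdf Y r = (D (df X r))%:E.
Proof.
rewrite /cdf /distribution /pushforward corresponds_setI; last first.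
  by rewrite -[X in measurable X]setTI; exact: measurable_quantile01.
have [F0 F1] : (0 <= df X r)%R /\ (df X r <= 1)%R.
  by have := df_itv X r; rewrite in_itv/= => /andP.
transitivity (Q (`]0%R, 1%R[ `&` `]-oo, df X r])).
  congr (Q _); apply/seteqP; split => u [/= u01];
    rewrite /Y /quantile01 !in_itv/= patchE mem_set//= quantile_le//.
(* The correspondence gives Q on ]0, u] only for u inside ]0, 1[. If F(r) = 0, the set is empty and
   D(0) = 0; if F(r) = 1, it is all of ]0, 1[ and D(1) = 1. *)
move: F0; rewrite le_eqVlt => /predU1P[<-|F0].
  rewrite (_ : _ `&` _ = set0) ?measure0 ?distortion0//.
  by apply/seteqP; split => u //=; rewrite !in_itv/= => -[/andP[/lt_geF->]].
move: F1; rewrite le_eqVlt => /predU1P[->|F1].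
  rewrite setIidl ?QD.1 ?distortion1// => u /=; rewrite !in_itv/= => /andP[_].
  exact: ltW.
rewrite -QD.2 ?in_itv/= ?F0//; congr (Q _).
apply/seteqP; split => u /=; rewrite !in_itv/=.
  by move=> [/andP[-> _] ->].
by move=> /andP[-> uF]; rewrite (le_lt_trans uF).
Qed.

Lemma ccdf_quantile01 (r : R) : ccdf Y r = (1 - D (df X r))%:E.
Proof. by rewrite ccdf_1_cdf cdf_quantile01. Qed.

(** The law of [quantile01 X] under Q and the Stieltjes measure of D o F agree on the intervals ]a,
    b], which determine the latter. *)
Lemma integral_Qdf (f : measurableTypeR R -> \bar R) :
  measurable_fun [set: measurableTypeR R] f ->
  \int[Qdf (D \o df X)]_x f x = \int[Q]_u f (quantile01 X u).
Proof.
have mY : measurable_fun [set: measurableTypeR R]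
    (quantile01 X : measurableTypeR R -> measurableTypeR R).
  exact: measurable_quantile01.
(* [measurableTypeR R], on which [Qdf] lives, and [R] carry the same
   sigma-algebra under different displays, whence this repackaging of [Y]. *)
pose Y' : {RV Q >-> measurableTypeR R} :=
  HB.pack (quantile01 X : measurableTypeR R -> measurableTypeR R)
    (isMeasurableFun.Build _ _ _ _ _ mY).
move=> mf; rewrite -(integral_distributionT Y')//.
apply: eq_measure_integral => A mA _.
apply: (@lebesgue_stieltjes_measure_unique _
  (D \o df X : cumulativeBounded 0%R 1%R) (distribution Q Y')) mA.
move=> _ [[a b] _ <-] /=.
have [ab|ba] := leP a b; last first.
  by rewrite set_itv_ge ?measure0// bnd_simp -leNgt ltW.
rewrite [LHS]QdfE//= EFinB -(cdf_quantile01 b) -(cdf_quantile01 a).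
(* The ray up to b is cut at a; the finite term [cdf Y a] then cancels. *)
have -> : cdf Y b = distribution Q Y `]a, b] + cdf Y a.
  rewrite /cdf addeC -measureU//; last first.
    apply/seteqP; split => x //=; rewrite !in_itv/=.
    by move=> [/le_lt_trans xa /andP[/xa]]; rewrite ltxx.
  by congr (distribution Q Y _); rewrite -itv_bndbnd_setU.
by rewrite addeK// cdf_quantile01.
Qed.

End distorted_quantile.

Theorem theorem3p3 (d : measure_display) (T : measurableType d) (R : realType)
    (P : probability T R) (D : distortion R)
    (Q : probability (measurableTypeR R) R) (QD : corresponds D Q) :
  [/\ LQ P Q = [set X : {RV P >-> R} |
        \int[Qdf (D \o df X)]_x (Num.max x 0%R)%:E < +oo],
      LQ P Q = [set X : {RV P >-> R} |
        \int[lebesgue_measure]_(x in `]0%R, +oo[) (1 - D (df X x))%:E < +oo]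
    & forall X : {RV P >-> R}, LQ P Q X ->
      [/\ rho Q X < +oo,
          rho Q X = \int[Qdf (D \o df X)]_x x%:E
        & rho Q X =
          \int[lebesgue_measure]_(x in `]0%R, +oo[) (1 - D (df X x))%:E -
          \int[lebesgue_measure]_(x in `]-oo, 0%R[) (D (df X x))%:E]].
Proof.
have QI (f : R -> \bar R) :
    \int[Q]_(u in `]0%R, 1%R[) f u = \int[Q]_u (f \_ `]0%R, 1%R[) u.
  exact: integral_mkcond.
have LQE (X : {RV P >-> R}) :
    \int[Q]_(u in `]0%R, 1%R[) (Num.max (quantile X u) 0%R)%:E =
    \int[Q]_u (Num.max (quantile01 X u) 0%R)%:E.
  rewrite QI; apply: eq_integral => u _.
  (* Extension by 0 commutes with the positive part, since max(0, 0) = 0. *)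
  by rewrite /quantile01 !patchE; case: ifP => //; rewrite maxxx.
have rhoE (X : {RV P >-> R}) : rho Q X = \int[Q]_u (quantile01 X u)%:E.
  rewrite /rho QI; apply: eq_integral => u _.
  by rewrite /quantile01 !patchE; case: ifP.
have maxE (X : {RV P >-> R}) : \int[Q]_u (Num.max (quantile01 X u) 0%R)%:E =
    \int[lebesgue_measure]_(x in `]0%R, +oo[) (1 - D (df X x))%:E.
  rewrite (integral_max0_ccdf (quantile01 X : {RV Q >-> R})).
  by apply: eq_integral => r _; exact: ccdf_quantile01.
have QdfmaxE (X : {RV P >-> R}) : \int[Qdf (D \o df X)]_x (Num.max x 0%R)%:E =
    \int[Q]_u (Num.max (quantile01 X u) 0%R)%:E.
  rewrite (integral_Qdf D QD)//; apply/measurable_EFinP.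
  exact: measurable_maxr.
split.
- by apply/seteqP; split => X; rewrite /LQ/= LQE QdfmaxE.
- by apply/seteqP; split => X; rewrite /LQ/= LQE maxE.
move=> X; rewrite /LQ/= LQE maxE => Xfin.
have rhoQE : rho Q X =
    \int[lebesgue_measure]_(x in `]0%R, +oo[) (1 - D (df X x))%:E -
    \int[lebesgue_measure]_(x in `]-oo, 0%R[) (D (df X x))%:E.
  rewrite rhoE (integral_ccdf_cdf (quantile01 X : {RV Q >-> R})).
  congr (_ - _); apply: eq_integral => r _; first exact: ccdf_quantile01.
  exact: cdf_quantile01.
split=> //.
(* The subtracted integral is nonnegative, so the finite upper-tail integral bounds [rho] from
   above. *)
- rewrite rhoQE; apply: le_lt_trans Xfin; rewrite geeDl// oppe_le0.
  apply: integral_ge0 => x _; rewrite lee_fin.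
  by have := distortion_itv D (df_itv X x); rewrite in_itv/= => /andP[].
- by rewrite rhoE (integral_Qdf D QD)//; exact/measurable_EFinP.
Qed.
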